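(* An almost contact metric structure $(F,\xi,\eta,g)$ on a $(2n+1)$-dimensional manifold $M$ is $\alpha$-Kenmotsu (for some differentiable function $\alpha$ on $M$) if and only if it is a structure of the class $\mathbf C_5$.
   Context: An almost contact metric structure on $M$, $\dim M=2n+1$, consists of a Riemannian metric $g=\langle\,,\rangle$, a unit vector field $\xi$, the 1-form $\eta(X)=\langle X,\xi\rangle$, and a $(1,1)$ tensor field $F$ with $F\xi=0$, preserving $V=\xi^\perp$, with $F^2=-I$ on $V$ and $\langle FX,FY\rangle=\langle X,Y\rangle$ for $X,Y\in V$. $\nabla$ is the Riemannian connection and $\Phi(X,Y)=\langle X,FY\rangle$. The structure is $\alpha$-Kenmotsu if $(\nabla_XF)Y=\alpha\{\langle FX,Y\rangle\xi-\eta(Y)FX\}$ for all vector fields $X,Y$, where $\alpha$ is a differentiable function on $M$. It is of class $\mathbf C_5$ if for all $X,Y,Z$ $$(\nabla_X\Phi)(Y,Z)=\tfrac1{2n}[\Phi(X,Z)\eta(Y)-\Phi(X,Y)\eta(Z)]\,\delta\eta,$$ where $\delta\eta=-\sum_{i=1}^n[(\nabla_{E_i}\eta)E_i+(\nabla_{FE_i}\eta)FE_i]$ for a local orthonormal basis $E_1,\dots,E_n,FE_1,\dots,FE_n,\xi$. *)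

(* Defs.v *)
From HB Require Import structures.
From mathcomp Require Import all_boot all_order all_algebra.
From mathcomp Require Import all_classical all_reals all_analysis.
Set Implicit Arguments.
Unset Strict Implicit.
Unset Printing Implicit Defensive.
Import Order.TTheory GRing.Theory Num.Theory.
Import numFieldNormedType.Exports.
Local Open Scope classical_set_scope.
Local Open Scope ring_scope.

(* Meant for open U. The differential is read off through the functions
   x |-> 'd f x v, one for each fixed v. *)
Fixpoint Ck_on (R : realType) (V W : normedModType R) (k : nat)
    (U : set V) (f : V -> W) : Prop :=
  if k is k'.+1 then
    (forall x, U x -> differentiable f x) /\
    (forall v : V, Ck_on k' U (fun x => 'd f x v))
  else forall x, U x -> {for x, continuous f}.

Definition smooth_on (R : realType) (V W : normedModType R)
    (U : set V) (f : V -> W) : Prop := forall k, Ck_on k U f.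

(* The functions chart i and chartV i are total; only their values on dom i and
   on chart i @` dom i are meaningful. The function chart_at picks a preferred
   chart around every point; the charts cover the manifold because of
   dom_chart_at. *)
Record manifold (R : realType) (d : nat) := Manifold {
  carrier :> topologicalType;
  carrier_hausdorff : hausdorff_space carrier;
  carrier_second_countable : @second_countable carrier;
  chart_index : Type;
  dom : chart_index -> set carrier;
  chart : chart_index -> carrier -> 'rV[R]_d;
  chartV : chart_index -> 'rV[R]_d -> carrier;
  dom_open : forall i, open (dom i);
  cod_open : forall i, open (chart i @` dom i);
  chartK : forall i p, dom i p -> chartV i (chart i p) = p;
  chart_continuous : forall i p, dom i p -> {for p, continuous (chart i)};
  chartV_continuous : forall i x, (chart i @` dom i) x ->
    {for x, continuous (chartV i)};
  transition_smooth : forall i j,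
    smooth_on (chart i @` (dom i `&` dom j)) (chart j \o chartV i);
  chart_at : carrier -> chart_index;
  dom_chart_at : forall p, dom (chart_at p) p
}.

Section Calculus.
Variables (R : realType) (d : nat) (M : manifold R d).

(* A tangent vector at p is given by its components in the preferred chart
   at p. *)
Definition tangent (p : M) : normedModType R := 'rV[R]_d.

(* Components of v in the chart i, for p in dom i. *)
Definition tcoord (i : chart_index M) (p : M) (v : tangent p) : 'rV[R]_d :=
  'd (chart i \o chartV (chart_at p)) (chart (chart_at p) p) v.

(* Functions and vector fields are total; when they are only locally defined,
   on an open set U, their values outside U are irrelevant. *)
Definition vfield := forall p : M, tangent p.

Definition smooth_fun (U : set M) (f : M -> R) : Prop :=
  forall i, smooth_on (chart i @` (U `&` dom i)) (f \o chartV i : _ -> R^o).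

Definition smooth_vfield (U : set M) (X : vfield) : Prop :=
  forall i, smooth_on (chart i @` (U `&` dom i))
    (fun x => tcoord i (X (chartV i x))).

Definition addv (X Y : vfield) : vfield := fun p => X p + Y p.
Definition scalev (f : M -> R) (X : vfield) : vfield := fun p => f p *: X p.

(* The derivative X f. *)
Definition lie (X : vfield) (f : M -> R) : M -> R := fun p =>
  'd (f \o chartV (chart_at p) : _ -> R^o) (chart (chart_at p) p) (X p).

Record riemannian_metric := RiemannianMetric {
  metric :> forall p : M, tangent p -> tangent p -> R;
  metric_linear : forall p (a : R) (u v w : tangent p),
    metric (a *: u + v) w = a * metric u w + metric v w;
  metric_sym : forall p (u v : tangent p), metric u v = metric v u;
  metric_pos : forall p (v : tangent p), v != 0 -> 0 < metric v v;
  metric_smooth : forall (U : set M) (X Y : vfield), open U ->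
    smooth_vfield U X -> smooth_vfield U Y ->
    smooth_fun U (fun p => metric (X p) (Y p))
}.

(* An affine connection, acting on the vector fields on any open set U and
   compatible with restriction. *)
Record is_connection (nabla : vfield -> vfield -> vfield) : Prop :=
  IsConnection {
  conn_smooth : forall (U : set M) X Y, open U ->
    smooth_vfield U X -> smooth_vfield U Y -> smooth_vfield U (nabla X Y);
  conn_local : forall (U : set M) X X' Y Y', open U ->
    smooth_vfield U X -> smooth_vfield U Y ->
    (forall p, U p -> X p = X' p) -> (forall p, U p -> Y p = Y' p) ->
    forall p, U p -> nabla X Y p = nabla X' Y' p;
  conn_addl : forall (U : set M) X X' Y, open U ->
    smooth_vfield U X -> smooth_vfield U X' -> smooth_vfield U Y ->
    forall p, U p -> nabla (addv X X') Y p = nabla X Y p + nabla X' Y p;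
  conn_scalel : forall (U : set M) f X Y, open U ->
    smooth_fun U f -> smooth_vfield U X -> smooth_vfield U Y ->
    forall p, U p -> nabla (scalev f X) Y p = f p *: nabla X Y p;
  conn_addr : forall (U : set M) X Y Y', open U ->
    smooth_vfield U X -> smooth_vfield U Y -> smooth_vfield U Y' ->
    forall p, U p -> nabla X (addv Y Y') p = nabla X Y p + nabla X Y' p;
  conn_leibniz : forall (U : set M) f X Y, open U ->
    smooth_fun U f -> smooth_vfield U X -> smooth_vfield U Y ->
    forall p, U p ->
      nabla X (scalev f Y) p = lie X f p *: Y p + f p *: nabla X Y p
}.

(* Torsion-freeness nabla_X Y - nabla_Y X = [X, Y] is an equality of
   derivations, where [X, Y] f = X (Y f) - Y (X f). *)
Record is_levi_civita (g : riemannian_metric)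
    (nabla : vfield -> vfield -> vfield) : Prop := IsLeviCivita {
  lc_connection : is_connection nabla;
  lc_metric : forall (U : set M) X Y Z, open U ->
    smooth_vfield U X -> smooth_vfield U Y -> smooth_vfield U Z ->
    forall p, U p ->
      lie X (fun q => g q (Y q) (Z q)) p
      = g p (nabla X Y p) (Z p) + g p (Y p) (nabla X Z p);
  lc_torsion_free : forall (U : set M) X Y f, open U ->
    smooth_vfield U X -> smooth_vfield U Y -> smooth_fun U f ->
    forall p, U p ->
      lie (nabla X Y) f p - lie (nabla Y X) f p
      = lie X (lie Y f) p - lie Y (lie X f) p
}.

End Calculus.

Arguments vfield {R d} M.
Arguments riemannian_metric {R d} M.

Record almost_contact_metric (R : realType) (n : nat)
    (M : manifold R n.*2.+1) := AlmostContactMetric {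
  acg : riemannian_metric M;
  xi : vfield M;
  F : forall p : M, tangent p -> tangent p;
  xi_smooth : smooth_vfield setT xi;
  F_smooth : forall (U : set M) (X : vfield M), open U ->
    smooth_vfield U X -> smooth_vfield U (fun p => F (X p));
  xi_unit : forall p, acg p (xi p) (xi p) = 1;
  F_linear : forall p (a : R) (u v : tangent p),
    F (a *: u + v) = a *: F u + F v;
  F_xi : forall p, F (xi p) = 0;
  F_preserves : forall p (v : tangent p),
    acg p v (xi p) = 0 -> acg p (F v) (xi p) = 0;
  F_square : forall p (v : tangent p),
    acg p v (xi p) = 0 -> F (F v) = - v;
  F_isometry : forall p (v w : tangent p),
    acg p v (xi p) = 0 -> acg p w (xi p) = 0 -> acg p (F v) (F w) = acg p v w
}.

Section AlmostContact.
Variables (R : realType) (n : nat) (M : manifold R n.*2.+1).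
Variables (S : almost_contact_metric M) (nabla : vfield M -> vfield M -> vfield M).

Local Notation "<[ u , v ]>" := (acg S _ u v).

Definition eta (X : vfield M) : M -> R := fun p => <[ X p, xi S p ]>.

Definition Fv (X : vfield M) : vfield M := fun p => F S (X p).

Definition Phi (X Y : vfield M) : M -> R := fun p => <[ X p, Fv Y p ]>.

Definition nabla_F (X Y : vfield M) : vfield M :=
  fun p => nabla X (Fv Y) p - Fv (nabla X Y) p.

Definition nabla_eta (X Y : vfield M) : M -> R :=
  fun p => lie X (eta Y) p - eta (nabla X Y) p.

Definition nabla_Phi (X Y Z : vfield M) : M -> R :=
  fun p => lie X (Phi Y Z) p - Phi (nabla X Y) Z p - Phi Y (nabla X Z) p.

(* E_1, ..., E_n, F E_1, ..., F E_n, xi is an orthonormal frame on U. *)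
Definition adapted_frame (U : set M) (E : 'I_n -> vfield M) : Prop :=
  (forall i, smooth_vfield U (E i)) /\
  (forall p, U p -> forall i j,
    [/\ <[ E i p, E j p ]> = (i == j)%:R,
        <[ Fv (E i) p, Fv (E j) p ]> = (i == j)%:R,
        <[ E i p, Fv (E j) p ]> = 0,
        <[ E i p, xi S p ]> = 0 &
        <[ Fv (E i) p, xi S p ]> = 0]).

(* The value at p does not depend on the frame. *)
Definition delta_eta (p : M) : R :=
  xget 0 [set c | exists (U : set M) (E : 'I_n -> vfield M),
    [/\ open U, U p, adapted_frame U E &
        c = - \sum_(i < n) (nabla_eta (E i) (E i) p
                            + nabla_eta (Fv (E i)) (Fv (E i)) p)]].

Definition alpha_Kenmotsu (alpha : M -> R) : Prop :=
  forall X Y : vfield M, smooth_vfield setT X -> smooth_vfield setT Y ->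
  forall p, nabla_F X Y p
    = alpha p *: (<[ Fv X p, Y p ]> *: xi S p - eta Y p *: Fv X p).

Definition class_C5 : Prop :=
  forall X Y Z : vfield M,
  smooth_vfield setT X -> smooth_vfield setT Y -> smooth_vfield setT Z ->
  forall p, nabla_Phi X Y Z p
    = ((2 * n)%:R)^-1 * (Phi X Z p * eta Y p - Phi X Y p * eta Z p)
      * delta_eta p.

End AlmostContact.

(* Main.v *)
Require Import Defs.
From HB Require Import structures.
From mathcomp Require Import all_boot all_order all_algebra.
From mathcomp Require Import all_classical all_reals all_analysis.
From mathcomp Require Import ring.
Set Implicit Arguments.
Unset Strict Implicit.
Unset Printing Implicit Defensive.
Import Order.TTheory GRing.Theory Num.Theory.
Import numFieldNormedType.Exports.
Local Open Scope classical_set_scope.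
Local Open Scope ring_scope.

(** Both conditions are the same tensor identity. Since nabla is metric,
    (nabla_X Phi)(Y, Z) = <Y, (nabla_X F) Z> ([nabla_PhiE]). Pairing the Kenmotsu
    identity with Y and using that F is skew ([F_skew]) gives
    (nabla_X Phi)(Y, Z) = - alpha (Phi(X, Z) eta(Y) - Phi(X, Y) eta(Z)),
    which is the C_5 identity as soon as delta eta = - 2n alpha.

    If the structure is alpha-Kenmotsu, the choice of xi as second argument gives
    nabla_X xi = alpha (X - eta(X) xi) ([Kenmotsu_nabla_xi]). Hence
    (nabla_E eta) E = <E, nabla_E xi> = alpha for every unit vector E orthogonal
    to xi, and the trace over an adapted frame is 2n alpha
    ([Kenmotsu_delta_eta]).

    Conversely, in class C_5 put alpha := - delta eta / 2n. The metric is
    nondegenerate, so the Kenmotsu identity holds at each point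
    ([C5_Kenmotsu]). It remains to see that alpha, defined point by point through
    a choice of frames, is smooth ([Kenmotsu_smooth]): by the formula for
    nabla_X xi, it is locally <nabla_Y xi, Y> / <Y, Y> for a horizontal field Y
    without zeros. If n = 0 then F = 0, and alpha = 0 will do.

    Both identities are about global fields, while delta eta is computed from
    local frames. The passage between the two rests on smooth cut-off functions
    ([bump_fun], [extend_vfield], [extend_vector]). The value of delta eta also
    requires that adapted frames exist near every point; they come from
    the Gram-Schmidt process ([adapted_frame_exists]). Most of what follows
    builds the calculus needed for these two points: C^k functions are stable
    under products and composition, and so on charts are smooth functions and
    fields. *)

(** * Calculus of C^k functions on an open set *)
Section Locality.
Variables (R : realType) (V W : normedModType R).
Implicit Types (f g : V -> W) (U : set V) (x : V).

(** The difference of the two functions vanishes near [x], so it is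
    differentiable there with zero differential; adding it to [f] gives [g]. *)
Lemma is_diff_near f g df x : {near x, f =1 g} -> is_diff x f df -> is_diff x g df.
Proof.
move=> fg dfx.
have fgx : f x = g x by exact: nbhs_singleton fg.
have [c0 h0] := @dcst _ V W 0 x.
have E : (g - f) \o shift x = cst ((g - f) x) + (0 : V -> W) +o_ 0 id.
  apply/eqaddoP => e e0.
  have : \forall h \near (0 : V), f (h + x) = g (h + x).
    have := fg; rewrite (near_shift 0) /=.
    by apply: filterS => h /=; rewrite subr0.
  apply: filterS => h /= E.
  rewrite !fctE /= E fgx !subrr /= addr0 subr0 normr0.
  by rewrite mulr_ge0 // ltW.
have D : 'd (g - f) x = 0 :> (V -> W) by apply: diff_unique.
have dgf : is_diff x (g - f) (0 : V -> W).
  by apply: DiffDef => //; apply/diff_locallyP; rewrite D; split.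
have -> : g = f + (g - f) by rewrite addrC subrK.
by apply: (is_diff_eq (is_diffD dfx dgf)); rewrite addr0.
Qed.

Lemma differentiable_near f g x :
  {near x, f =1 g} -> differentiable f x -> differentiable g x.
Proof. by move=> fg /differentiableP/(is_diff_near fg)[]. Qed.

Lemma diff_near f g x : {near x, f =1 g} -> differentiable f x ->
  'd f x = 'd g x :> (V -> W).
Proof. by move=> fg /differentiableP/(is_diff_near fg)[_ ->]. Qed.

(** Membership in the class is a condition at each point, but it involves the
    values on a neighbourhood: this is where openness of [U] matters. *)
Lemma Ck_on_eq k f g U : open U -> (forall x, U x -> f x = g x) ->
  Ck_on k U f -> Ck_on k U g.
Proof.
move=> oU; elim: k f g => [|k IH] f g fg /=.
  move=> cf x Ux.
  suff : g @ x --> f x by rewrite (fg _ Ux).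
  apply: cvg_trans (cf _ Ux); apply: near_eq_cvg.
  have : nbhs x U by exact: open_nbhs_nbhs.
  by apply: filterS => y /fg.
have nfg x : U x -> {near x, f =1 g}.
  by move=> Ux; have : nbhs x U by [exact: open_nbhs_nbhs]; apply: filterS.
move=> [df dfk]; split=> [x Ux|v].
  exact: (differentiable_near (nfg _ Ux) (df _ Ux)).
by apply: IH (dfk v) => x Ux; rewrite (diff_near (nfg _ Ux) (df _ Ux)).
Qed.

(** Smoothness is local: all later global objects are obtained by gluing. *)
Lemma Ck_on_glue k f U :
  (forall x, U x -> exists2 U', U' x & Ck_on k U' f) -> Ck_on k U f.
Proof.
elim: k f => [|k IH] f /= H.
  by move=> x /H[U' Ux]; apply.
split=> [x /H[U' Ux []]|v]; first by move=> + _; apply.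
by apply: IH => x /H[U' Ux [_ h]]; exists U'.
Qed.

Lemma Ck_on_continuous k f U : Ck_on k U f -> Ck_on 0 U f.
Proof.
by case: k => // k [df _] x /df; exact: differentiable_continuous.
Qed.

Lemma Ck_onW k f U : Ck_on k.+1 U f -> Ck_on k U f.
Proof.
elim: k f => [|k IH] f; first exact: Ck_on_continuous.
by move=> [df dfk]; split=> // v; apply: IH; exact: dfk.
Qed.

Lemma Ck_on_cst k U (a : W) : Ck_on k U (cst a).
Proof.
elim: k a => [|k IH] a /=; first by move=> x _; exact: cvg_cst.
split=> // v; rewrite (_ : (fun _ => _) = cst 0)//.
by apply/funext => x; rewrite diff_cst.
Qed.

Lemma Ck_onD k U f g : Ck_on k U f -> Ck_on k U g ->
  open U -> Ck_on k U (fun x => f x + g x).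
Proof.
move=> + + oU; elim: k f g => [|k IH] f g /=.
  by move=> cf cg x Ux; apply: cvgD; [exact: cf|exact: cg].
move=> [df dfk] [dg dgk]; split=> [x Ux|v].
  by apply: (@differentiableD _ _ _ f g); [exact: df|exact: dg].
apply: Ck_on_eq (IH _ _ (dfk v) (dgk v)) => // x Ux.
by rewrite (@diffD _ _ _ f g)//; [exact: df|exact: dg].
Qed.

End Locality.

Section Composition.
Variables (R : realType).

Lemma Ck_on_lin (V W W' : normedModType R) (L : {linear W -> W'}) k
    (U : set V) (f : V -> W) : continuous L -> open U ->
  Ck_on k U f -> Ck_on k U (fun x => L (f x)).
Proof.
move=> cL oU; elim: k f => [|k IH] f /=.
  by move=> cf x Ux; apply: continuous_comp; [exact: cf|exact: cL].
move=> [df dfk]; split=> [x Ux|v].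
  by apply: differentiable_comp; [exact: df|exact: linear_differentiable].
apply: Ck_on_eq (IH _ (dfk v)) => // x Ux.
rewrite (@diff_comp _ _ _ _ f L)/= ?diff_lin//; first exact: df.
exact: linear_differentiable.
Qed.

Section Scale.
Variable W : normedModType R.

(** Scaling, with its scalar argument in a normed module, so that the
    differential of a bilinear map gives the product rule. *)
Definition scale_fun (a : R^o) (w : W) : W := a *: w.

Lemma scale_fun_bilinear :
  bilinear_for (GRing.Scale.Law.clone _ _ *:%R _)
    (GRing.Scale.Law.clone _ _ *:%R _) scale_fun.
Proof.
split=> [u'|u] a x y /=; rewrite /scale_fun.
- by rewrite scalerDl scalerA.
- by rewrite scalerDr !scalerA [a * u]mulrC.
Qed.

HB.instance Definition _ :=
  bilinear_isBilinear.Build R R^o W W _ _ scale_fun scale_fun_bilinear.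

Lemma is_diff_scale (V : normedModType R) (f : V -> R^o) (g : V -> W) x df dg :
  is_diff x f df -> is_diff x g dg ->
  is_diff x (fun y => f y *: g y) (fun v => f x *: dg v + df v *: g x).
Proof.
move=> dfx dgx.
have cs : continuous (fun p : R^o * W => scale_fun p.1 p.2).
  by move=> [a w]; exact: scale_continuous.
have H : is_diff (f x, g x) (fun p : R^o * W => scale_fun p.1 p.2)
   (fun q => scale_fun (f x) q.2 + scale_fun q.1 (g x)).
  by apply: DiffDef; [exact: differentiable_bilin|rewrite diff_bilin].
rewrite -[(fun y => f y *: g y)]/((fun p : R^o * W => scale_fun p.1 p.2)
   \o (fun y => (f y, g y))).
exact: is_diff_eq.
Qed.

Lemma Ck_on_scale (V : normedModType R) k (U : set V) (f : V -> R^o) (g : V -> W) :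
  open U -> Ck_on k U f -> Ck_on k U g -> Ck_on k U (fun x => f x *: g x).
Proof.
move=> oU; elim: k f g => [|k IH] f g /=.
  by move=> cf cg x Ux; apply: cvgZ; [exact: cf|exact: cg].
move=> Hf Hg; have [df dfk] := Hf; have [dg dgk] := Hg.
have D x : U x -> is_diff x (fun y => f y *: g y)
    (fun v => f x *: 'd g x v + 'd f x v *: g x).
  move=> Ux; apply: is_diff_scale; apply: differentiableP; auto.
split=> [x /D[]//|v].
apply: (@Ck_on_eq _ _ _ _
  (fun x => f x *: 'd g x v + 'd f x v *: g x)) => //.
  by move=> x /D[_ ->].
by apply: Ck_onD => //; apply: IH => //; exact: Ck_onW.
Qed.

End Scale.

Lemma Ck_on_sum (V W : normedModType R) k (U : set V) (I : Type) (r : seq I)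
    (P : pred I) (f : I -> V -> W) :
  open U -> (forall i, P i -> Ck_on k U (f i)) ->
  Ck_on k U (fun x => \sum_(i <- r | P i) f i x).
Proof.
move=> oU Hf; elim: r => [|i r IH].
  apply: Ck_on_eq (@Ck_on_cst _ _ _ k U 0) => // x _.
  by rewrite big_nil.
case Pi : (P i); last first.
  by apply: Ck_on_eq IH => // x _; rewrite big_cons Pi.
apply: (@Ck_on_eq _ _ _ _ (fun x => f i x + \sum_(j <- r | P j) f j x)) => //.
  by move=> x _; rewrite big_cons Pi.
by apply: Ck_onD => //; exact: Hf.
Qed.

(** The differential of [g \o f] at [x] in the direction [v] is the differential
    of [g] applied to a vector that moves with [x], whereas the class C^k only
    controls differentials in fixed directions. Expanding that vector in a basis
    [e] with coordinates [c] turns it into a sum of products to which the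
    induction hypothesis applies. *)
Lemma Ck_on_comp (V V' W : normedModType R) m (c : 'I_m -> {linear V' -> R^o})
    (e : 'I_m -> V') k (U : set V) (U' : set V') (f : V -> V') (g : V' -> W) :
  (forall i, continuous (c i)) -> (forall v, v = \sum_i c i v *: e i) ->
  open U -> (forall x, U x -> U' (f x)) ->
  Ck_on k U f -> Ck_on k U' g -> Ck_on k U (g \o f).
Proof.
move=> cc ce oU fU; elim: k f fU g => [|k IH] f fU g /=.
  move=> cf cg x Ux; apply: continuous_comp; first exact: cf.
  exact/cg/fU.
move=> Hf [dg dgk]; have [df dfk] := Hf; split=> [x Ux|v].
  by apply: differentiable_comp; [exact: df|exact/dg/fU].
apply: (@Ck_on_eq _ _ _ _ (fun x => \sum_i c i ('d f x v) *:
   (fun y => 'd g y (e i)) (f x))) => //.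
  move=> x Ux; rewrite (@diff_comp _ _ _ _ f g); [|exact: df|exact/dg/fU].
  rewrite [in RHS]/= [X in _ = 'd g (f x) X]ce linear_sum.
  by apply: eq_bigr => i _; rewrite linearZ.
apply: Ck_on_sum => // i _; apply: Ck_on_scale => //.
  exact: (Ck_on_lin (cc i) oU (dfk v)).
exact: (IH f fU (fun y => 'd g y (e i)) (Ck_onW Hf) (dgk (e i))).
Qed.

Definition coordf d (i : 'I_d) (v : 'rV[R]_d) : R^o := v ord0 i.

Lemma coordf_linear d i : linear (@coordf d i).
Proof. by move=> a u v; rewrite /coordf !mxE. Qed.

HB.instance Definition _ d i :=
  GRing.isLinear.Build R 'rV[R]_d R^o _ (@coordf d i) (coordf_linear i).

Lemma coordf_continuous d i : continuous (@coordf d i).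
Proof. exact: coord_continuous. Qed.

Lemma Ck_on_comp_rV (V W : normedModType R) d k (U : set V) (U' : set 'rV[R]_d)
    (f : V -> 'rV[R]_d) (g : 'rV[R]_d -> W) :
  open U -> (forall x, U x -> U' (f x)) ->
  Ck_on k U f -> Ck_on k U' g -> Ck_on k U (g \o f).
Proof.
apply: (@Ck_on_comp _ _ _ d (@coordf d) (fun i => delta_mx ord0 i)).
  exact: coordf_continuous.
by move=> v; rewrite [LHS]row_sum_delta.
Qed.

Lemma Ck_on_comp_R (V W : normedModType R) k (U : set V) (U' : set R^o)
    (f : V -> R^o) (g : R^o -> W) :
  open U -> (forall x, U x -> U' (f x)) ->
  Ck_on k U f -> Ck_on k U' g -> Ck_on k U (g \o f).
Proof.
apply: (@Ck_on_comp _ _ _ 1 (fun=> idfun : {linear R^o -> R^o}) (fun=> 1)).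
  by move=> _ x; exact: cvg_id.
by move=> v; rewrite big_ord1 [_%:A]mulr1.
Qed.

End Composition.

(** * Real functions used for normalisation and cut-off *)
Section RealFunctions.
Variable R : realType.

(** Raises the order by one: a function whose derivative is expressed by
    functions of the same family is smooth by induction. *)
Lemma Ck_on_is_derive k (U : set R^o) (f f' : R^o -> R^o) : open U ->
  (forall x, U x -> is_derive x 1 f (f' x)) -> Ck_on k U f' -> Ck_on k.+1 U f.
Proof.
move=> oU Df f'k.
have D x : U x -> differentiable f x.
  by move=> /Df[dfx _]; apply/derivable1_diffP.
split=> // v; apply: (@Ck_on_eq _ _ _ _ (fun x => v *: f' x)) => //.
  by move=> x Ux; rewrite diff1E ?derive1E; [have [_ ->] := Df _ Ux|exact: D].
by apply: Ck_on_scale => //; exact: Ck_on_cst.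
Qed.

Lemma smooth_inv : smooth_on [set x : R^o | x != 0] (GRing.inv : R^o -> R^o).
Proof.
have oU : open [set x : R^o | x != 0].
  by apply: (@open_neq _ (0 : R)).
elim=> [|k IH]; first by move=> x /= x0; exact: inv_continuous.
apply: (@Ck_on_is_derive _ _ _ (fun x => (- 1 : R) *: (x^-1 *: x^-1))) => //.
  move=> x /= x0.
  apply: (is_derive_eq (is_deriveV x0 (is_derive_id x (1 : R)))).
  by rewrite scaleN1r [LHS]mulr1 expr2 invfM.
by apply: Ck_on_scale => //; [exact: Ck_on_cst|exact: Ck_on_scale].
Qed.

Lemma smooth_sqrt : smooth_on [set x : R^o | 0 < x] (Num.sqrt : R^o -> R^o).
Proof.
have oU : open [set x : R^o | 0 < x] by exact: (@open_gt _ (0 : R)).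
elim=> [|k IH]; first by move=> x _; exact: sqrt_continuous.
apply: (@Ck_on_is_derive _ _ _
  (fun x : R^o => (2^-1 : R^o) *: (Num.sqrt x)^-1 : R^o)) => //.
  move=> x /= x0; apply: (is_derive_eq (is_derive1_sqrt x0)).
  by rewrite invfM.
apply: Ck_on_scale => //; first exact: Ck_on_cst.
apply: (Ck_on_comp_R oU _ IH (@smooth_inv k)) => x /= x0.
by rewrite gt_eqF// sqrtr_gt0.
Qed.

End RealFunctions.

Section Flat.
Variable R : realType.

(** The functions t^-k exp (-1/t), extended by 0 to t <= 0. The whole family is
    needed because it is closed under differentiation up to linear
    combinations; the cut-offs below are built from the case k = 0. *)
Definition flat_exp (k : nat) (t : R) : R :=
  if 0 < t then t^-1 ^+ k * expR (- t^-1) else 0.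

Lemma flat_exp_gt0 k t : 0 < t -> 0 < flat_exp k t.
Proof. by move=> t0; rewrite /flat_exp t0 mulr_gt0 ?expR_gt0 ?exprn_gt0 ?invr_gt0. Qed.

Lemma flat_exp_le0 k t : t <= 0 -> flat_exp k t = 0.
Proof. by rewrite /flat_exp ltNge => ->. Qed.

(** With y = 1/t this is y^(k+1) / (k+1)! <= exp y. *)
Lemma flat_exp_bound k t : `|flat_exp k t| <= k.+1`!%:R * `|t|.
Proof.
have [t0|t0] := leP t 0; first by rewrite flat_exp_le0 // normr0 mulr_ge0.
rewrite !gtr0_norm ?flat_exp_gt0 // /flat_exp t0 expRN.
rewrite ler_pdivrMr ?expR_gt0 // -[X in _ * X * _]invrK mulrAC.
rewrite ler_pdivlMr ?invr_gt0 // -exprSr mulrC -ler_pdivrMr ?ltr0n ?fact_gt0 //.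
have t'0 : 0 <= t^-1 by rewrite invr_ge0 ltW.
by apply: le_trans (expR_ge1Dxn k t'0); rewrite lerDr.
Qed.

Lemma flat_expS k t : flat_exp k t = flat_exp k.+1 t * t.
Proof.
rewrite /flat_exp; case: ltP => t0; last by rewrite mul0r.
by rewrite exprS -mulrA [RHS]mulrC mulVKf // gt_eqF.
Qed.

Lemma flat_exp_continuous0 k : {for 0, continuous (flat_exp k)}.
Proof.
suff : flat_exp k @ (0 : R) --> (0 : R).
  by rewrite -[X in _ --> X -> _](flat_exp_le0 k (lexx 0)); exact.
apply/cvgr0Pnorm_le => e e0.
near=> t; apply: le_trans (flat_exp_bound k t) _.
rewrite mulrC -ler_pdivlMr ?ltr0n ?fact_gt0 //.
near: t; apply: (cvgr0_norm_le (fun t : R => t)) => //.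
by rewrite divr_gt0 // ltr0n fact_gt0.
Unshelve. all: by end_near. Qed.

(** At 0 the difference quotient of [flat_exp k] is [flat_exp k.+1], which is
    continuous with value 0 there. *)
Lemma is_derive_flat_exp k (t : R) :
  is_derive t 1 (flat_exp k) (flat_exp k.+2 t - k%:R * flat_exp k.+1 t).
Proof.
have [t0|t0|->] := ltgtP t 0.
- rewrite !flat_exp_le0 ?ltW // mulr0 subr0.
  apply: near_eq_is_derive (is_derive_cst (0 : R) t 1).
  near=> s; rewrite flat_exp_le0 //; near: s.
  exact: lt_le_nbhsl.
- have t1 : t != 0 by rewrite gt_eqF.
  have Dv := is_deriveV t1 (is_derive_id t (1 : R)).
  have De : is_derive t 1 (fun s : R => expR (- s^-1)) (expR (- t^-1) * (t ^- 2)).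
    apply: (is_derive_eq (is_derive1_comp (is_derive_expR _) (is_deriveN Dv))).
    by rewrite scaleNr opprK [_ *: _]mulr1.
  have := is_deriveM (is_deriveX k Dv) De.
  move=> D; apply: near_eq_is_derive (is_derive_eq D _).
    near=> s; rewrite /flat_exp ifT; last by near: s; exact: lt_nbhsr.
    by rewrite /= exprfctE.
  rewrite /flat_exp t0 exprfctE.
  case: k {D} => [|k] /=.
    rewrite !mul0r subr0 scale0r scaler0 addr0 /= exprVn.
    by rewrite [LHS]mul1r mulrC.
  rewrite -!exprVn /GRing.scale /= !exprS expr0.
  move: (t^-1 : R) (expR _ : R) (t^-1 ^+ k : R) (k.+1%:R : R) => u E p c.
  ring.
- rewrite !flat_exp_le0 // mulr0 subr0; apply/is_derive1_caratheodory.
  exists (flat_exp k.+1); split; last exact: flat_exp_le0.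
    by move=> s; rewrite (flat_exp_le0 k (lexx 0)) !subr0 flat_expS.
  exact: flat_exp_continuous0.
Unshelve. all: by end_near. Qed.

Lemma smooth_flat_exp k : smooth_on setT (flat_exp k : R^o -> R^o).
Proof.
move=> m; elim: m k => [|m IH] k.
  move=> t _; apply/differentiable_continuous/derivable1_diffP.
  by have [] := is_derive_flat_exp k t.
apply: (@Ck_on_is_derive _ _ _ _
  (fun t => flat_exp k.+2 t + (- k%:R : R^o) *: flat_exp k.+1 t)).
- exact: openT.
- move=> t _; apply: (is_derive_eq (is_derive_flat_exp k t)).
  by rewrite [_ *: _]mulNr.
- apply: Ck_onD; [exact: IH| |exact: openT].
  apply: Ck_on_scale; [exact: openT|exact: Ck_on_cst|exact: IH].
Qed.

End Flat.

(** * Smooth functions and vector fields on a manifold *)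
Section Charts.
Variables (R : realType) (d : nat) (M : manifold R d).
Implicit Types (i j : chart_index M) (U : set M) (p q : M).

Lemma open_chart_image i U : open U -> open (chart i @` (U `&` dom i)).
Proof.
move=> oU; rewrite openE => _ [p [Up ip] <-].
have cip : (chart i @` dom i) (chart i p) by exists p.
have n1 : nbhs (chart i p) (chart i @` dom i).
  by apply: open_nbhs_nbhs; split=> //; exact: cod_open.
have n2 : nbhs (chart i p) (chartV i @^-1` U).
  apply: (chartV_continuous cip); rewrite chartK //.
  exact: open_nbhs_nbhs.
apply: filterS (filterI n1 n2) => _ [[q iq <-] /=].
by rewrite chartK // => Uq; exists q.
Qed.

Lemma nbhs_chart i U p : dom i p -> nbhs p U ->
  nbhs (chart i p) (chartV i @^-1` U).
Proof.
move=> ip nU; apply: chartV_continuous; first by exists p.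
by rewrite chartK.
Qed.

Lemma smooth_on_chart_glue (W : normedModType R) i U (f : 'rV[R]_d -> W) :
  (forall p, U p -> exists2 U', U' p &
     smooth_on (chart i @` (U' `&` dom i)) f) ->
  smooth_on (chart i @` (U `&` dom i)) f.
Proof.
move=> H k; apply: Ck_on_glue => _ [p [Up ip] <-].
have [U' U'p sf] := H p Up.
by exists (chart i @` (U' `&` dom i)); [exists p|exact: sf].
Qed.

Lemma smooth_on_chart_eq (W : normedModType R) i U (f g : 'rV[R]_d -> W) :
  open U -> (forall p, U p -> dom i p -> f (chart i p) = g (chart i p)) ->
  smooth_on (chart i @` (U `&` dom i)) f ->
  smooth_on (chart i @` (U `&` dom i)) g.
Proof.
move=> oU fg sf k; apply: Ck_on_eq (sf k); first exact: open_chart_image.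
by move=> _ [p [Up ip] <-]; exact: fg.
Qed.

Section Fun.
Implicit Types f g : M -> R.

Lemma smooth_fun_glue U f :
  (forall p, U p -> exists2 U', U' p & smooth_fun U' f) -> smooth_fun U f.
Proof.
move=> H i; apply: smooth_on_chart_glue => p /H[U' U'p sf].
by exists U'.
Qed.

Lemma smooth_fun_sub U U' f : U' `<=` U -> smooth_fun U f -> smooth_fun U' f.
Proof. by move=> UU sf; apply: smooth_fun_glue => p /UU Up; exists U. Qed.

Lemma smooth_fun_eq U f g : open U -> (forall p, U p -> f p = g p) ->
  smooth_fun U f -> smooth_fun U g.
Proof.
move=> oU fg sf i; apply: smooth_on_chart_eq (sf i) => // p Up ip /=.
by rewrite chartK // fg.
Qed.

Lemma smooth_fun_cst U (a : R) : smooth_fun U (cst a).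
Proof. by move=> i k; exact: Ck_on_cst. Qed.

Lemma smooth_funM U f g : open U -> smooth_fun U f -> smooth_fun U g ->
  smooth_fun U (fun p => f p * g p).
Proof.
move=> oU sf sg i k.
by apply: (@Ck_on_scale R R^o); [exact: open_chart_image|exact: sf|exact: sg].
Qed.

(** Here [P] is a set on which the outer function is known to be smooth, such as
    the positive reals for the square root. *)
Lemma smooth_fun_comp U (P : set R^o) (h : R^o -> R^o) f : open U ->
  smooth_on P h -> smooth_fun U f -> (forall p, U p -> P (f p)) ->
  smooth_fun U (h \o f).
Proof.
move=> oU sh sf fP i k.
apply: (Ck_on_comp_R _ _ (sf i k) (sh k)); first exact: open_chart_image.
by move=> _ [p [Up ip] <-] /=; rewrite chartK //; exact: fP.
Qed.

Lemma smooth_funV U f : open U -> smooth_fun U f ->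
  (forall p, U p -> f p != 0) -> smooth_fun U (fun p => (f p)^-1).
Proof. by move=> oU sf f0; apply: smooth_fun_comp (@smooth_inv R) sf f0. Qed.

Lemma smooth_fun_sqrt U f : open U -> smooth_fun U f ->
  (forall p, U p -> 0 < f p) -> smooth_fun U (fun p => Num.sqrt (f p)).
Proof. by move=> oU sf f0; apply: smooth_fun_comp (@smooth_sqrt R) sf f0. Qed.

Lemma smooth_fun_continuous U f p : open U -> U p -> smooth_fun U f ->
  {for p, continuous f}.
Proof.
move=> oU Up sf; set i := chart_at p; have ip : dom i p := dom_chart_at p.
have cfV : {for chart i p, continuous (f \o chartV i : _ -> R^o)}.
  by apply: (sf i 0%N); exists p.
have c : {for p, continuous ((f \o chartV i : _ -> R^o) \o chart i)}.
  by apply: continuous_comp; [exact: chart_continuous|exact: cfV].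
have : ((f \o chartV i) \o chart i) @ p --> f p.
  have E : (f \o chartV i) (chart i p) = f p by rewrite /= chartK.
  by rewrite -[X in _ --> X]E; exact: c.
apply: cvg_trans; apply: near_eq_cvg.
have : nbhs p (dom i) by apply: open_nbhs_nbhs; split=> //; exact: dom_open.
by apply: filterS => q iq /=; rewrite chartK.
Qed.

Lemma smooth_fun_gt0_nbhs U f p : open U -> U p -> smooth_fun U f -> 0 < f p ->
  exists U', [/\ open U', U' p, U' `<=` U & forall q, U' q -> 0 < f q].
Proof.
move=> oU Up sf fp.
have cf := smooth_fun_continuous oU Up sf.
have : nbhs p [set q | 0 < f q] by exact: (cvgr_gt _ cf).
rewrite nbhsE => -[V [oV Vp] Vf].
exists (U `&` V); split=> //; first exact: openI.
by move=> q [_ /Vf].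
Qed.

End Fun.

Section VectorFields.
Implicit Types X Y : vfield M.

Lemma smooth_vfield_glue U X :
  (forall p, U p -> exists2 U', U' p & smooth_vfield U' X) -> smooth_vfield U X.
Proof.
move=> H i; apply: smooth_on_chart_glue => p /H[U' U'p sf].
by exists U'.
Qed.

Lemma smooth_vfield_sub U U' X : U' `<=` U ->
  smooth_vfield U X -> smooth_vfield U' X.
Proof. by move=> UU sf; apply: smooth_vfield_glue => p /UU Up; exists U. Qed.

Lemma smooth_vfield_eq U X Y : open U -> (forall p, U p -> X p = Y p) ->
  smooth_vfield U X -> smooth_vfield U Y.
Proof.
move=> oU fg sf i; apply: smooth_on_chart_eq (sf i) => // p Up ip /=.
by rewrite chartK // fg.
Qed.

Lemma smooth_vfield0 U : open U -> smooth_vfield U (fun p => 0 : tangent p).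
Proof.
move=> oU i; apply: (@smooth_on_chart_eq _ _ _ (cst 0)) => //.
  by move=> p _ _; rewrite /tcoord linear0.
by move=> k; exact: Ck_on_cst.
Qed.

Lemma smooth_vfieldD U X Y : open U -> smooth_vfield U X -> smooth_vfield U Y ->
  smooth_vfield U (Defs.addv X Y).
Proof.
move=> oU sX sY i; apply: (@smooth_on_chart_eq _ _ _ (fun x =>
   tcoord i (X (chartV i x)) + tcoord i (Y (chartV i x)))) => //.
  by move=> p _ _; rewrite /tcoord linearD.
by move=> k; apply: Ck_onD; [exact: sX|exact: sY|exact: open_chart_image].
Qed.

Lemma smooth_vfieldZ U f X : open U -> smooth_fun U f -> smooth_vfield U X ->
  smooth_vfield U (scalev f X).
Proof.
move=> oU sf sX i; apply: (@smooth_on_chart_eq _ _ _ (fun x =>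
   f (chartV i x) *: tcoord i (X (chartV i x)))) => //.
  by move=> p _ _; rewrite /tcoord /scalev linearZ.
by move=> k; apply: Ck_on_scale; [exact: open_chart_image|exact: sf|exact: sX].
Qed.

Lemma smooth_vfield_sum U (I : Type) (r : seq I) (X : I -> vfield M) : open U ->
  (forall a, smooth_vfield U (X a)) ->
  smooth_vfield U (fun p => \sum_(a <- r) X a p).
Proof.
move=> oU sX; elim: r => [|a r IH].
  by apply: smooth_vfield_eq (smooth_vfield0 oU) => // p _; rewrite big_nil.
apply: smooth_vfield_eq (smooth_vfieldD oU (sX a) IH) => // p _.
by rewrite big_cons.
Qed.

End VectorFields.

(** * Coordinate fields, cut-offs and extension of fields *)
Section CoordinateFields.
Implicit Types (w : 'rV[R]_d).

Lemma differentiable_transition i j q : dom i q -> dom j q ->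
  differentiable (chart j \o chartV i) (chart i q).
Proof.
move=> iq jq; have [+ _] := @transition_smooth _ _ M i j 1%N.
by apply; exists q.
Qed.

Lemma transitionK i j k q : dom i q -> dom j q ->
  {near chart i q, (chart k \o chartV j) \o (chart j \o chartV i)
     =1 chart k \o chartV i}.
Proof.
move=> iq jq.
have : nbhs (chart i q) (chartV i @^-1` dom j).
  apply: nbhs_chart => //; apply: open_nbhs_nbhs; split=> //; exact: dom_open.
by apply: filterS => x /= jx; rewrite chartK.
Qed.

(** The field whose components in the chart [j] are the constants [w], written
    in the preferred chart at each point as the encoding of tangent vectors
    requires. *)
Definition coord_field j w : vfield M :=
  fun q => 'd (chart (chart_at q) \o chartV j) (chart j q) w.

(** Chain rule for the transition from [j] to [i] through the preferred chart,
    the only one in which tangent vectors are given. *)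
Lemma tcoord_coord_field i j q w : dom i q -> dom j q ->
  tcoord i (coord_field j w q) = 'd (chart i \o chartV j) (chart j q) w.
Proof.
move=> iq jq; set a := chart_at q; have aq : dom a q := dom_chart_at q.
have E : (chart a \o chartV j) (chart j q) = chart a q by rewrite /= chartK.
have D1 := differentiable_transition jq aq.
have D2 := differentiable_transition aq iq.
have N := transitionK i jq aq.
rewrite -(diff_near N); last by apply: differentiable_comp; rewrite ?E.
by rewrite diff_comp ?E.
Qed.

(** In the chart [i] the field is a directional derivative of one transition map
    composed with the inverse transition map. *)
Lemma smooth_coord_field j w : smooth_vfield (dom j) (coord_field j w).
Proof.
move=> i k.
have oD : open (chart i @` (dom j `&` dom i)).
  by apply: open_chart_image; exact: dom_open.
apply: (@Ck_on_eq _ _ _ _ ((fun y => 'd (chart i \o chartV j) y w) \o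
   (chart j \o chartV i))) => //.
  by move=> _ [q [jq iq] <-] /=; rewrite chartK // tcoord_coord_field.
have [_ Dk] := @transition_smooth _ _ M j i k.+1.
apply: (Ck_on_comp_rV _ _ _ (Dk w)) => //.
  by move=> _ [q [jq iq] <-] /=; rewrite chartK //; exists q.
by rewrite setIC; exact: transition_smooth.
Qed.

Lemma coord_field_chart_at p (v : tangent p) : coord_field (chart_at p) v p = v.
Proof.
rewrite /coord_field; set a := chart_at p; have ap : dom a p := dom_chart_at p.
have N : {near chart a p, id =1 chart a \o chartV a}.
  have : nbhs (chart a p) (chart a @` dom a).
    by apply: open_nbhs_nbhs; split; [exact: cod_open|exists p].
  by apply: filterS => _ [q aq <-] /=; rewrite chartK.
by rewrite -(diff_near N) ?diff_val.
Qed.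

End CoordinateFields.

Section Bump.

(** The function r^2 - |y - y0|^2, positive exactly on a Euclidean ball. The
    Euclidean square is used because the norm on row vectors, a maximum, is not
    smooth. *)
Definition paraboloid (r : R) (y0 y : 'rV[R]_d) : R^o :=
  r ^+ 2 + \sum_(k < d) (- 1 : R^o) *:
    ((coordf k y + - coordf k y0) *: (coordf k y + - coordf k y0)).

Lemma smooth_paraboloid r y0 : smooth_on setT (paraboloid r y0).
Proof.
move=> m; have oT := @openT 'rV[R]_d.
apply: Ck_onD => //; first exact: Ck_on_cst.
apply: Ck_on_sum => // k _; apply: Ck_on_scale => //; first exact: Ck_on_cst.
have C : Ck_on m setT (fun y => coordf k y + - coordf k y0).
  apply: Ck_onD => //; last exact: Ck_on_cst.
  apply: (@Ck_on_lin _ _ _ _ (coordf k) _ _ idfun) => //.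
    exact: coordf_continuous.
  case: m => [x _|m]; first exact: cvg_id.
  split=> // v; apply: (@Ck_on_eq _ _ _ _ (cst v)) => //.
    by move=> x _; rewrite diff_val.
  exact: Ck_on_cst.
exact: Ck_on_scale.
Qed.

Lemma paraboloid_gt0 r y0 y k : 0 <= r -> 0 < paraboloid r y0 y ->
  `|y ord0 k - y0 ord0 k| <= r.
Proof.
move=> r0; rewrite /paraboloid -scaler_sumr scaleN1r subr_gt0 => H.
rewrite -(ler_pXn2r (_ : 0 < 2)%N) ?nnegrE // real_normK ?num_real //.
apply: le_trans (ltW H); rewrite (bigD1 k) //= lerDl.
by apply: sumr_ge0 => i _; exact: sqr_ge0.
Qed.

(** In a chart, [psi] is exp (-1/(r^2 - |y - y0|^2)), extended by 0. It vanishes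
    outside the preimage [K] of a closed box contained in the image of [U]; this
    box is compact, hence [K] is compact, hence closed since the manifold is
    Hausdorff. So [psi] is smooth both on the chart domain and on the open
    complement of [K], and these two sets cover the manifold. *)
Lemma bump_fun U p : open U -> U p ->
  exists (psi : M -> R) (K : set M), [/\ smooth_fun setT psi, 0 < psi p,
    closed K, K `<=` U & forall q, ~ K q -> psi q = 0].
Proof.
move=> oU Up; set a := chart_at p; have ap : dom a p := dom_chart_at p.
set y0 := chart a p; set W := chart a @` (U `&` dom a).
have nW : nbhs y0 W.
  by apply: open_nbhs_nbhs; split; [exact: open_chart_image|exists p].
have [e /= e0 eW] := (nbhs_ballP _ _).1 nW.
pose r := e / 2; have r0 : 0 < r by rewrite divr_gt0.
pose B := [set v : 'rV[R]_d | forall k, v ord0 k \in `[y0 ord0 k - r, y0 ord0 k + r]].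
have BW : B `<=` W.
  move=> v Bv; apply: eW; split=> // i k; rewrite (ord1 i).
  rewrite /ball /= distrC; apply: (@le_lt_trans _ _ r).
    by have := Bv k; rewrite in_itv /= ler_distl.
  by rewrite /r ltr_pdivrMr // mulr_natr mulr2n ltrDl.
have cB : compact B.
  apply: (@rV_compact _ _ (fun k => `[y0 ord0 k - r, y0 ord0 k + r]%classic)).
  by move=> k; exact: segment_compact.
pose K := chartV a @` B.
have cK : closed K.
  apply: compact_closed; first exact: carrier_hausdorff.
  apply: continuous_compact => //.
  apply: continuous_in_subspaceT => v /set_mem /BW [q [Uq aq] <-].
  by apply: chartV_continuous; exists q.
have KU : K `<=` U `&` dom a.
  by move=> _ [_ /BW[q [Uq aq] <-] <-]; rewrite chartK.
pose psi q := if `[< dom a q >] then flat_exp 0 (paraboloid r y0 (chart a q)) else 0.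
have psi0 q : ~ K q -> psi q = 0.
  move=> Kq; rewrite /psi; case: ifPn => // /asboolP aq.
  apply: flat_exp_le0; rewrite leNgt; apply/negP => H; apply: Kq.
  exists (chart a q); last exact: chartK.
  by move=> k; rewrite in_itv /= -ler_distl; exact: paraboloid_gt0 (ltW r0) H.
exists psi, K; split=> //.
- apply: smooth_fun_glue => q _; have [aq|naq] := pselect (dom a q).
    exists (dom a) => //.
    have oa := dom_open a.
    apply: (@smooth_fun_eq _ (flat_exp 0 \o (paraboloid r y0 \o chart a))) => //.
      by move=> q' aq'; rewrite /psi /= asboolT.
    apply: (smooth_fun_comp (P := setT)) => //; first exact: smooth_flat_exp.
    move=> i k.
    apply: (@Ck_on_comp_rV _ _ _ _ _ _ setT (chart a \o chartV i)) => //.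
    + exact: open_chart_image.
    + by rewrite setIC; exact: transition_smooth.
    + exact: smooth_paraboloid.
  exists (~` K); first by move=> /KU[].
  have oK : open (~` K) by exact: closed_openC.
  apply: (@smooth_fun_eq _ (cst 0)) => //; first by move=> ? /psi0 ->.
  exact: smooth_fun_cst.
- rewrite /psi asboolT //; apply: flat_exp_gt0.
  rewrite /paraboloid big1 ?addr0 ?exprn_gt0 // => k _.
  by rewrite subrr scale0r scaler0.
- by move=> q /KU[].
Qed.

(** A local field becomes global after multiplication by a function that is
    positive at the given point. For an expression that is tensorial in the
    field, dividing by [psi p] recovers the value on the local field. *)
Lemma extend_vfield U (X : vfield M) p : open U -> U p -> smooth_vfield U X ->
  exists psi : M -> R, [/\ smooth_fun setT psi, 0 < psi p &
    smooth_vfield setT (scalev psi X)].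
Proof.
move=> oU Up sX; have [psi [K [spsi psip cK KU psi0]]] := bump_fun oU Up.
exists psi; split=> //; apply: smooth_vfield_glue => q _.
have [Uq|nUq] := pselect (U q).
  exists U => //; apply: smooth_vfieldZ => //.
  exact: smooth_fun_sub spsi.
exists (~` K); first by move=> /KU.
have oK : open (~` K) by exact: closed_openC.
apply: smooth_vfield_eq (smooth_vfield0 oK) => // q' /psi0 E.
by rewrite /scalev E scale0r.
Qed.

(** Lets pointwise identities be tested on global fields, the only ones to which
    the conditions on the structure refer. *)
Lemma extend_vector p (v : tangent p) :
  exists X : vfield M, smooth_vfield setT X /\ X p = v.
Proof.
have oT := @openT M.
have [psi [_ psip sX]] := extend_vfield (@dom_open _ _ M (chart_at p))
  (dom_chart_at p) (smooth_coord_field (chart_at p) v).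
exists (scalev (cst (psi p)^-1) (scalev psi (coord_field (chart_at p) v))).
split; first by apply: smooth_vfieldZ => //; exact: smooth_fun_cst.
by rewrite /scalev coord_field_chart_at scalerK // gt_eqF.
Qed.

End Bump.

End Charts.

(** * Linear algebra of the metric and of the almost contact structure *)
Section Metric.
Variables (R : realType) (d : nat) (M : manifold R d) (g : riemannian_metric M).
Variable p : M.
Implicit Types u v w : tangent p.

Lemma metric_linearl w : linear (fun u => g p u w : R^o).
Proof. by move=> a u v; exact: metric_linear. Qed.

(** The metric as a bundled linear map, to inherit the lemmas on linear maps. *)
Definition metricl w : {linear tangent p -> R^o} :=
  HB.pack (fun u => g p u w : R^o) (GRing.isLinear.Build _ _ _ _ _ (metric_linearl w)).

Lemma metric0l w : g p 0 w = 0. Proof. exact: (linear0 (metricl w)). Qed.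
Lemma metricDl u v w : g p (u + v) w = g p u w + g p v w.
Proof. exact: (linearD (metricl w)). Qed.
Lemma metricBl u v w : g p (u - v) w = g p u w - g p v w.
Proof. exact: (linearB (metricl w)). Qed.
Lemma metricNl u w : g p (- u) w = - g p u w.
Proof. exact: (linearN (metricl w)). Qed.
Lemma metricZl a u w : g p (a *: u) w = a * g p u w.
Proof. exact: (linearZ_LR (metricl w)). Qed.
Lemma metric_suml (I : Type) (r : seq I) (u : I -> tangent p) w :
  g p (\sum_(i <- r) u i) w = \sum_(i <- r) g p (u i) w.
Proof. exact: (linear_sum (metricl w)). Qed.
Lemma metricBr u v w : g p w (u - v) = g p w u - g p w v.
Proof. by rewrite !(Defs.metric_sym g w) metricBl. Qed.
Lemma metricZr a u w : g p w (a *: u) = a * g p w u.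
Proof. by rewrite !(Defs.metric_sym g w) metricZl. Qed.
Lemma metric0r w : g p w 0 = 0.
Proof. by rewrite Defs.metric_sym metric0l. Qed.

Lemma metric_nondeg u : (forall w, g p w u = 0) -> u = 0.
Proof.
move=> H; apply/eqP; apply: contraT => /(@Defs.metric_pos _ _ _ g).
by rewrite H ltxx.
Qed.

(** Fewer than [d] linear equations in [d] unknowns have a nonzero solution. *)
Lemma exists_orthogonal m (a : 'I_m -> tangent p) : (m < d)%N ->
  exists2 v : tangent p, v != 0 & forall j, g p v (a j) = 0.
Proof.
move=> md.
pose A := \matrix_(i < d, j < m) g p (delta_mx ord0 i) (a j).
have k0 : kermx A != 0.
  rewrite -mxrank_eq0 mxrank_ker -lt0n subn_gt0.
  exact: leq_ltn_trans (rank_leq_col A) md.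
exists (nz_row (kermx A)); first by rewrite nz_row_eq0.
move=> j; set v := nz_row _.
have : v *m A = 0 by apply/sub_kermxP; exact: nz_row_sub.
move=> /matrixP/(_ ord0 j); rewrite !mxE => E.
rewrite [X in g p X](row_sum_delta v) metric_suml -[RHS]E.
by apply: eq_bigr => i _; rewrite metricZl mxE.
Qed.

End Metric.

Section Pointwise.
Variables (R : realType) (n : nat) (M : manifold R n.*2.+1).
Variables (S : almost_contact_metric M) (p : M).
Implicit Types u v w : tangent p.
Notation g := (acg S p).
Notation xip := (xi S p).

Lemma F_zero : F S (0 : tangent p) = 0.
Proof.
by have := F_linear S (-1) (0 : tangent p) 0; rewrite scaler0 addr0 scaleN1r addNr.
Qed.
Lemma F_scale a u : F S (a *: u) = a *: F S u.
Proof. by have := F_linear S a u 0; rewrite F_zero !addr0. Qed.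
Lemma F_add u v : F S (u + v) = F S u + F S v.
Proof. by have := F_linear S 1 u v; rewrite !scale1r. Qed.

(** Orthogonal projection onto the hyperplane of vectors orthogonal to xi. *)
Definition horizontal u : tangent p := u - g u xip *: xip.

Lemma horizontal_xi u : g (horizontal u) xip = 0.
Proof. by rewrite metricBl metricZl xi_unit mulr1 subrr. Qed.

Lemma F_horizontal u : F S (horizontal u) = F S u.
Proof. by rewrite F_add -scaleNr F_scale F_xi scaler0 addr0. Qed.

Lemma F_perp_xi u : g (F S u) xip = 0.
Proof. by rewrite -F_horizontal; apply/F_preserves/horizontal_xi. Qed.

Lemma metric_F_horizontal u v : g (F S u) (horizontal v) = g (F S u) v.
Proof. by rewrite metricBr metricZr F_perp_xi mulr0 subr0. Qed.

(** On horizontal vectors: <Fu, v> = <FFu, Fv> = - <u, Fv>, by the isometry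
    property; vertical components contribute nothing as F kills xi and has
    horizontal values. *)
Lemma F_skew u v : g (F S u) v = - g u (F S v).
Proof.
rewrite -metric_F_horizontal -[F S u]F_horizontal.
rewrite -F_isometry; [|exact/F_preserves/horizontal_xi|exact: horizontal_xi].
rewrite F_square ?horizontal_xi // metricNl F_horizontal.
by rewrite Defs.metric_sym metric_F_horizontal Defs.metric_sym.
Qed.

Lemma F_self u : g u (F S u) = 0.
Proof.
have := F_skew u u; rewrite Defs.metric_sym => /eqP.
by rewrite -addr_eq0 -mulr2n mulrn_eq0 /= => /eqP.
Qed.

Lemma F_F u : F S (F S u) = - horizontal u.
Proof. by rewrite -(F_horizontal u) F_square ?horizontal_xi. Qed.

End Pointwise.

(** In dimension one every vector is a multiple of xi. *)
Lemma F_eq0_dim1 (R : realType) n (M : manifold R n.*2.+1)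
    (S : almost_contact_metric M) p (u : tangent p) : n = 0%N -> F S u = 0.
Proof.
move=> n0; subst n.
have x0 : xi S p ord0 ord0 != 0.
  apply: contraPneq (xi_unit S p) => x0.
  have -> : xi S p = 0 by apply/rowP => i; rewrite (ord1 i) x0 mxE.
  by rewrite metric0l => /esym/eqP; rewrite oner_eq0.
have -> : u = (u ord0 ord0 / xi S p ord0 ord0) *: xi S p.
  by apply/rowP => i; rewrite (ord1 i) mxE divfK.
by rewrite F_scale F_xi scaler0.
Qed.

(** * Existence of adapted frames *)
Section Frames.
Variables (R : realType) (n : nat) (M : manifold R n.*2.+1).
Variables (S : almost_contact_metric M).
Notation g := (acg S).

(** The relations that involve [F S (E i)] on both sides follow from these, since
    F is skew and is an isometry on horizontal vectors. *)
Definition partial_frame k (U : set M) (E : nat -> vfield M) :=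
  (forall i, (i < k)%N -> smooth_vfield U (E i)) /\
  (forall p, U p -> forall i j, (i < k)%N -> (j < k)%N ->
    [/\ g p (E i p) (E j p) = (i == j)%:R,
        g p (E i p) (F S (E j p)) = 0 & g p (E i p) (xi S p) = 0]).

Definition project_out k (E : nat -> vfield M) (X : vfield M) : vfield M :=
  fun p => X p + ((- g p (X p) (xi S p)) *: xi S p +
    \sum_(i < k) ((- g p (X p) (E i p)) *: E i p +
                  (- g p (X p) (F S (E i p))) *: F S (E i p))).

Lemma sum_opp_delta k (c : nat -> R) j : (j < k)%N ->
  \sum_(i < k) - c i * (i == j :> nat)%:R = - c j.
Proof.
move=> jk; rewrite (bigD1 (Ordinal jk)) //= eqxx mulr1 big1 ?addr0 // => i ij.
rewrite (_ : (_ == _) = false) ?mulr0 //.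
by apply: contraNF ij => /eqP/= E; apply/eqP/val_inj.
Qed.

Lemma project_out_orthogonal k U E X p : partial_frame k U E -> U p ->
  g p (project_out k E X p) (xi S p) = 0 /\
  forall j, (j < k)%N -> g p (project_out k E X p) (E j p) = 0 /\
     g p (project_out k E X p) (F S (E j p)) = 0.
Proof.
move=> [_ H] Up; have {}H := H p Up.
split=> [|j jk].
  rewrite !metricDl metricZl xi_unit mulr1 metric_suml big1.
    by rewrite addr0 subrr.
  move=> i _; have [_ _ h] := H i i (ltn_ord i) (ltn_ord i).
  by rewrite metricDl !metricZl h F_perp_xi !mulr0 addr0.
have [_ _ hj] := H j j jk jk.
split.
  rewrite !metricDl metricZl (Defs.metric_sym g (xi S p)) hj mulr0 add0r metric_suml.
  rewrite (eq_bigr (fun i : 'I_k => - g p (X p) (E i p) * (i == j :> nat)%:R)).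
    by rewrite (sum_opp_delta (fun i => g p (X p) (E i p)) jk) subrr.
  move=> i _; have [h1 h2 _] := H i j (ltn_ord i) jk.
  by rewrite metricDl !metricZl h1 F_skew h2 oppr0 mulr0 addr0.
rewrite !metricDl metricZl (Defs.metric_sym g (xi S p)) F_perp_xi mulr0 add0r metric_suml.
rewrite (eq_bigr (fun i : 'I_k => - g p (X p) (F S (E i p)) * (i == j :> nat)%:R)).
  by rewrite (sum_opp_delta (fun i => g p (X p) (F S (E i p))) jk) subrr.
move=> i _; have [h1 h2 h3] := H i j (ltn_ord i) jk.
rewrite metricDl !metricZl h2 mulr0 add0r.
have [_ _ hi] := H i i (ltn_ord i) (ltn_ord i).
by rewrite F_isometry // h1.
Qed.

Lemma smooth_project_out k U E X : open U -> partial_frame k U E ->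
  smooth_vfield U X -> smooth_vfield U (project_out k E X).
Proof.
move=> oU [sE _] sX.
have sxi : smooth_vfield U (xi S) by exact: smooth_vfield_sub (@xi_smooth _ _ _ S).
have sN A : smooth_vfield U A ->
    smooth_vfield U (fun p => (- g p (X p) (A p)) *: A p).
  move=> sA; apply: smooth_vfieldZ => //.
  apply: (@smooth_fun_eq _ _ _ _ (fun p => cst (-1) p * g p (X p) (A p))) => //.
    by move=> q _; rewrite mulN1r.
  by apply: smooth_funM => //; [exact: smooth_fun_cst|exact: metric_smooth].
apply: smooth_vfieldD => //; apply: smooth_vfieldD => //; first exact: sN.
apply: (@smooth_vfield_sum _ _ _ _ _ _ (fun (i : 'I_k) p => _ *: _ + _ *: _)) => // i.
have sEi := sE i (ltn_ord i).
by apply: smooth_vfieldD => //; apply: sN => //; exact: F_smooth.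
Qed.

(** One Gram-Schmidt step. As k < n, some nonzero vector at [p] is orthogonal to
    xi and to all the [E i] and [F S (E i)]; a field extending it, with its
    components along these removed, still has this value at [p], so it can be
    normalised near [p]. *)
Lemma partial_frame_extend k U E p : (k < n)%N -> open U -> U p ->
  partial_frame k U E -> exists U' E', [/\ open U', U' p & partial_frame k.+1 U' E'].
Proof.
move=> kn oU Up fr; have [sE HE] := fr.
(* All the vectors to be avoided, in the order E, F E, xi. *)
pose a (j : 'I_(k + k).+1) : tangent p :=
  if (j < k)%N then E j p else if (j < k + k)%N then F S (E (j - k)%N p) else xi S p.
have [|v v0 va] := @exists_orthogonal _ _ _ g p _ a.
  by rewrite ltnS addnn ltn_double.
have vxi : g p v (xi S p) = 0.
  by have := va ord_max; rewrite /a /= ltnNge leq_addr ltnn.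
have vE i : (i < k)%N -> g p v (E i p) = 0.
  move=> ik; have iK : (i < (k + k).+1)%N by rewrite ltnS ltnW // ltn_addr.
  by have := va (Ordinal iK); rewrite /a /= ik.
have vFE i : (i < k)%N -> g p v (F S (E i p)) = 0.
  move=> ik; have iK : (k + i < (k + k).+1)%N by rewrite ltnS leq_add2l ltnW.
  have := va (Ordinal iK).
  by rewrite /a /= ltnNge leq_addr /= ltn_add2l ik addKn.
have [X [sX Xp]] := extend_vector v.
pose P := project_out k E X.
have Pp : P p = v.
  rewrite /P /project_out Xp vxi oppr0 scale0r add0r big1 ?addr0 // => i _.
  by rewrite vE // vFE // !oppr0 !scale0r addr0.
have sP : smooth_vfield U P.
  by apply: smooth_project_out => //; exact: smooth_vfield_sub sX.
have sg : smooth_fun U (fun q => g q (P q) (P q)) by exact: metric_smooth.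
have [|U' [oU' U'p UU' gpos]] := smooth_fun_gt0_nbhs oU Up sg.
  by rewrite Pp; exact: Defs.metric_pos.
pose c q := (Num.sqrt (g q (P q) (P q)))^-1.
pose N := scalev c P.
have sc : smooth_fun U' c.
  have sg' := smooth_fun_sub UU' sg.
  apply: smooth_funV => //; first exact: smooth_fun_sqrt.
  by move=> q /gpos gq; rewrite gt_eqF // sqrtr_gt0.
pose E' i := if i == k then N else E i.
have E'k : E' k = N by rewrite /E' eqxx.
have E'lt i : (i < k)%N -> E' i = E i by move=> ik; rewrite /E' ltn_eqF.
have ltS i : (i < k.+1)%N -> i = k \/ (i < k)%N.
  by rewrite ltnS leq_eqVlt => /orP[/eqP|]; [left|right].
exists U', E'; split=> //; split.
  move=> i /ltS[->|ik]; first rewrite E'k.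
    by apply: smooth_vfieldZ => //; exact: smooth_vfield_sub sP.
  by rewrite E'lt //; exact: smooth_vfield_sub (sE i ik).
move=> q U'q; have Uq := UU' _ U'q.
have [Pxi PE] := project_out_orthogonal X fr Uq.
have gN w : g q (N q) w = c q * g q (P q) w by exact: metricZl.
have NN : g q (N q) (N q) = 1.
  have Pgt0 := gpos _ U'q.
  rewrite gN [g q (P q) (N q)]metricZr mulrA /c -invfM -expr2 sqr_sqrtr ?ltW //.
  by rewrite mulVf // gt_eqF.
have Nxi : g q (N q) (xi S q) = 0 by rewrite gN Pxi mulr0.
have NE j : (j < k)%N -> g q (N q) (E j q) = 0.
  by move=> /PE[h _]; rewrite gN h mulr0.
have NFE j : (j < k)%N -> g q (N q) (F S (E j q)) = 0.
  by move=> /PE[_ h]; rewrite gN h mulr0.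
move=> i j /ltS[->|ik] /ltS[->|jk].
- by rewrite E'k eqxx; split; [exact: NN|exact: F_self|exact: Nxi].
- rewrite E'k E'lt // gtn_eqF //.
  by split; [exact: NE|exact: NFE|exact: Nxi].
- rewrite E'k E'lt // ltn_eqF //; have [_ _ hi] := HE q Uq i i ik ik.
  split; [by rewrite Defs.metric_sym NE| |exact: hi].
  by apply: oppr_inj; rewrite -F_skew Defs.metric_sym NFE // oppr0.
- by rewrite !E'lt //; exact: HE.
Qed.

Lemma adapted_frame_exists p : exists (U : set M) (E : 'I_n -> vfield M),
  [/\ open U, U p & adapted_frame S U E].
Proof.
have H k : (k <= n)%N -> exists U E, [/\ open U, U p & partial_frame k U E].
  elim: k => [_|k IH kn].
    exists setT, (fun _ => xi S); split=> //; exact: openT.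
  have [U [E [oU Up fr]]] := IH (ltnW kn).
  exact: partial_frame_extend fr.
have [U [E [oU Up [sE HE]]]] := H n (leqnn n).
exists U, (fun i => E i); split=> //; split=> [i|q Uq i j]; first exact: sE.
have [h1 h2 h3] := HE q Uq i j (ltn_ord i) (ltn_ord j).
have [_ _ h4] := HE q Uq j j (ltn_ord j) (ltn_ord j).
by split=> //; [rewrite F_isometry|exact: F_perp_xi].
Qed.

End Frames.

(** * The covariant derivative of the structure *)
Section LeviCivita.
Variables (R : realType) (n : nat) (M : manifold R n.*2.+1).
Variables (S : almost_contact_metric M) (nabla : vfield M -> vfield M -> vfield M).
Hypothesis LC : is_levi_civita (acg S) nabla.
Notation g := (acg S).
Let conn := lc_connection LC.
Let sxi U : smooth_vfield U (xi S).
Proof. exact: smooth_vfield_sub (@xi_smooth _ _ _ S). Qed.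

Lemma nabla0 U X p : open U -> smooth_vfield U X -> U p ->
  nabla X (fun q => 0 : tangent q) p = 0.
Proof.
move=> oU sX Up; have s0 := smooth_vfield0 oU.
have := conn_addr conn oU sX s0 s0 Up.
rewrite (_ : Defs.addv _ _ = fun q => 0 : tangent q); last first.
  by apply: functional_extensionality_dep => q; rewrite /Defs.addv addr0.
by move/eqP; rewrite -subr_eq0 opprD addNKr oppr_eq0 => /eqP.
Qed.

(** Differentiate <xi, xi> = 1. *)
Lemma nabla_xi_perp U X p : open U -> smooth_vfield U X -> U p ->
  g p (nabla X (xi S) p) (xi S p) = 0.
Proof.
move=> oU sX Up; have := lc_metric LC oU sX (sxi U) (sxi U) Up.
rewrite (_ : (fun q => _) = cst 1); last by apply/funext => q; rewrite xi_unit.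
rewrite /lie (_ : _ \o _ = cst 1) // diff_cst /=.
rewrite [X in _ + X]Defs.metric_sym => /esym/eqP.
by rewrite -mulr2n mulrn_eq0 /= => /eqP.
Qed.

Lemma nabla_etaE U X Y p : open U -> smooth_vfield U X -> smooth_vfield U Y ->
  U p -> nabla_eta S nabla X Y p = g p (Y p) (nabla X (xi S) p).
Proof.
move=> oU sX sY Up; rewrite /nabla_eta /Defs.eta (lc_metric LC oU sX sY (sxi U) Up).
by rewrite addrC addKr.
Qed.

Lemma nabla_PhiE X Y Z p :
  smooth_vfield setT X -> smooth_vfield setT Y -> smooth_vfield setT Z ->
  nabla_Phi S nabla X Y Z p = g p (Y p) (nabla_F S nabla X Z p).
Proof.
move=> sX sY sZ; have oT := @openT M.
have sFZ : smooth_vfield setT (Fv S Z) by exact: F_smooth.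
rewrite /nabla_Phi /Phi (lc_metric LC oT sX sY sFZ I) /nabla_F metricBr.
by rewrite [X in X - _ - _]addrC addrK.
Qed.

(** For a global field, apply the Kenmotsu identity to Y := xi. Since F xi = 0 it
    reads F (nabla_X xi) = alpha F X, and applying F once more recovers
    nabla_X xi, which is horizontal. A local field is reduced to a global one by
    [extend_vfield], as nabla_X xi is tensorial in X. The local version is
    needed because adapted frames are only local; [alpha] is an arbitrary
    function because its smoothness is deduced from this identity
    ([Kenmotsu_smooth]). *)
Lemma Kenmotsu_nabla_xi alpha U X p : alpha_Kenmotsu S nabla alpha ->
  open U -> smooth_vfield U X -> U p ->
  nabla X (xi S) p = alpha p *: horizontal S (X p).
Proof.
move=> HK oU sX Up.
have [psi [spsi psip sY]] := extend_vfield oU Up sX.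
set Y := scalev psi X in sY.
have E : nabla Y (xi S) p = alpha p *: horizontal S (Y p).
  have := HK Y (xi S) sY (sxi _) p; rewrite /nabla_F.
  rewrite (_ : Fv S (xi S) = fun q => 0 : tangent q); last first.
    by apply: functional_extensionality_dep => q; exact: F_xi.
  rewrite (nabla0 openT sY I) /Fv /Defs.eta F_perp_xi scale0r xi_unit scale1r.
  rewrite !sub0r scalerN => /oppr_inj /(congr1 (F S (p := p))).
  rewrite F_scale !F_F scalerN => /oppr_inj <-.
  by rewrite /horizontal (nabla_xi_perp openT sY I) scale0r subr0.
have sps : smooth_fun U psi by exact: smooth_fun_sub spsi.
have := conn_scalel conn oU sps sX (sxi U) Up; rewrite -/Y E /Y /scalev.
have -> : horizontal S (psi p *: X p) = psi p *: horizontal S (X p).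
  by rewrite /horizontal metricZl scalerBr scalerA.
rewrite scalerA mulrC -scalerA => /scalerI -> //.
by rewrite gt_eqF.
Qed.

(** By [nabla_etaE] and [Kenmotsu_nabla_xi] each of the 2n terms of the trace is
    alpha, whatever the frame. Existence of a frame rules out the default value
    of the choice operator in [delta_eta]. *)
Lemma Kenmotsu_delta_eta alpha p : alpha_Kenmotsu S nabla alpha ->
  delta_eta S nabla p = - ((2 * n)%:R * alpha p).
Proof.
move=> HK; rewrite /delta_eta; case: xgetP => [c -> /=|H]; last first.
  have [U [E [oU Up fr]]] := adapted_frame_exists S p.
  by case: (H _ (ex_intro _ U (ex_intro _ E (And4 oU Up fr erefl)))).
move=> [U [E [oU Up [sE HE] ->]]]; congr (- _).
rewrite (eq_bigr (fun=> alpha p *+ 2)) => [|i _].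
  by rewrite sumr_const card_ord -mulrnA mulr_natl.
have [h1 h2 h3 h4 h5] := HE p Up i i; rewrite eqxx in h1 h2.
have sFE : smooth_vfield U (Fv S (E i)) by exact: F_smooth.
rewrite !(nabla_etaE oU) // !(Kenmotsu_nabla_xi HK oU) // /horizontal.
by rewrite h4 h5 !scale0r !subr0 !metricZr h1 h2 !mulr1 mulr2n.
Qed.

(** For n = 0 the factor 1/(2n) is 0, and both sides vanish because F = 0. *)
Lemma Kenmotsu_C5 alpha : alpha_Kenmotsu S nabla alpha -> class_C5 S nabla.
Proof.
move=> HK X Y Z sX sY sZ p; rewrite nabla_PhiE // HK // (Kenmotsu_delta_eta p HK).
rewrite /Phi /Fv /Defs.eta.
have [n0|n0] := posnP n.
  by rewrite !(F_eq0_dim1 S _ n0) metric0l metric0r scale0r scaler0 subrr scaler0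
    metric0r !mul0r subrr mulr0 mul0r.
have n2 : (2 * n)%:R != 0 :> R by rewrite pnatr_eq0 muln_eq0 -lt0n n0.
rewrite metricZr metricBr !metricZr F_skew.
rewrite [g p (Y p) (F S (X p))]Defs.metric_sym F_skew.
move: ((2 * n)%:R : R) n2 => c c0; by field.
Qed.

Lemma exists_horizontal p : (0 < n)%N ->
  exists2 v : tangent p, v != 0 & g p v (xi S p) = 0.
Proof.
move=> n0; have [|v v0 H] := @exists_orthogonal _ _ _ g p 1 (fun=> xi S p).
  by rewrite ltnS double_gt0.
by exists v => //; exact: (H ord0).
Qed.

(** Near a point, take a horizontal field Y' that does not vanish there. Then
    nabla_Y' xi = alpha Y', so alpha is the quotient of the smooth functions
    <nabla_Y' xi, Y'> and <Y', Y'>. Such a Y' exists only if n > 0. *)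
Lemma Kenmotsu_smooth alpha : (0 < n)%N -> alpha_Kenmotsu S nabla alpha ->
  smooth_fun setT alpha.
Proof.
move=> n0 HK; have oT := @openT M; apply: smooth_fun_glue => p _.
have [v v0 vxi] := exists_horizontal p n0.
have [Y [sY Yp]] := extend_vector v.
pose Y' : vfield M := fun q => Y q + (- g q (Y q) (xi S q)) *: xi S q.
have sN : smooth_fun setT (fun q => - g q (Y q) (xi S q)).
  apply: (@smooth_fun_eq _ _ _ _ (fun q => cst (-1) q * g q (Y q) (xi S q))) => //.
    by move=> q _; rewrite mulN1r.
  by apply: smooth_funM => //; [exact: smooth_fun_cst|exact: metric_smooth].
have sY' : smooth_vfield setT Y'.
  by apply: smooth_vfieldD => //; exact: smooth_vfieldZ.
have Y'E q : Y' q = horizontal S (Y q) by rewrite /Y' scaleNr.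
have sD : smooth_fun setT (fun q => g q (Y' q) (Y' q)) by exact: metric_smooth.
have [|U [oU Up UT Dpos]] := smooth_fun_gt0_nbhs oT I sD (p := p).
  by rewrite Y'E /horizontal Yp vxi scale0r subr0; exact: Defs.metric_pos.
exists U => //.
apply: (@smooth_fun_eq _ _ _ _ (fun q =>
  g q (nabla Y' (xi S) q) (Y' q) * (g q (Y' q) (Y' q))^-1)) => //.
  move=> q Uq; rewrite (Kenmotsu_nabla_xi HK oT sY' I).
  rewrite [horizontal S _](_ : _ = Y' q); last first.
    by rewrite /horizontal [X in X *: _](_ : _ = 0) ?scale0r ?subr0 // Y'E horizontal_xi.
  by rewrite metricZl mulfK // gt_eqF // Dpos.
apply: smooth_funM => //.
  apply: metric_smooth => //; last exact: smooth_vfield_sub sY'.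
  by apply: smooth_vfield_sub (conn_smooth conn oT sY' (sxi _)).
apply: smooth_funV => //; first exact: smooth_fun_sub sD.
by move=> q /Dpos; rewrite lt0r => /andP[].
Qed.

(** The C_5 identity is the Kenmotsu identity tested against a third field, and
    every tangent vector is a value of a global field. *)
Lemma C5_Kenmotsu : class_C5 S nabla ->
  alpha_Kenmotsu S nabla (fun p => - ((2 * n)%:R^-1 * delta_eta S nabla p)).
Proof.
move=> HC X Z sX sZ p; apply/eqP; rewrite -subr_eq0; apply/eqP.
apply: (@metric_nondeg _ _ _ g) => w.
have [Y [sY Yp]] := extend_vector w.
have := HC X Y Z sX sY sZ p; rewrite nabla_PhiE // Yp => E.
rewrite metricBr E.
rewrite /Phi /Fv /Defs.eta metricZr metricBr !metricZr F_skew Yp.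
rewrite [g p w (F S (X p))]Defs.metric_sym F_skew.
ring.
Qed.

End LeviCivita.

Theorem proposition7p5 (R : realType) (n : nat) (M : manifold R n.*2.+1)
    (S : almost_contact_metric M) (nabla : vfield M -> vfield M -> vfield M)
    (nabla_LC : is_levi_civita (acg S) nabla) :
  (exists alpha : M -> R,
     smooth_fun setT alpha /\ alpha_Kenmotsu S nabla alpha)
  <-> class_C5 S nabla.
Proof.
split=> [[alpha [_ HK]]|HC]; first exact: Kenmotsu_C5 HK.
have HK := C5_Kenmotsu nabla_LC HC.
have [n0|n0] := posnP n; last first.
  by eexists; split; [exact: Kenmotsu_smooth HK|exact: HK].
exists (cst 0); split; first exact: smooth_fun_cst.
move=> X Y sX sY p; rewrite HK // /Fv !(F_eq0_dim1 S _ n0).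
by rewrite metric0l scale0r scaler0 subrr !scaler0.
Qed.
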